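(* Let $p, q \in \mathbb{R}$. Then $$\int_{0}^{\infty} \frac{e^{-pt} - e^{-qt}}{1-e^{-t}} \, dt = \psi(q) - \psi(p).$$
   Context: $\psi$ denotes the digamma function, $\psi(x) = \frac{d}{dx}\log\Gamma(x) = \Gamma'(x)/\Gamma(x)$, where $\Gamma$ is the gamma function defined by $\Gamma(x)=\int_0^\infty t^{x-1}e^{-t}\,dt$. The formula is entry 3.311.7 in the table of integrals of Gradshteyn and Ryzhik.
   Formalization: The formal theorem assumes p > 0 and q > 0 instead of arbitrary real p, q, because the integral defining Γ (hence ψ) converges only for positive arguments and the left-hand integral diverges when p ≠ q and min(p, q) ≤ 0. *)

(* Defs.v *)
From HB Require Import structures.
From mathcomp Require Import all_boot all_order all_algebra.
From mathcomp Require Import all_classical all_reals all_analysis.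

Set Implicit Arguments.
Unset Strict Implicit.
Unset Printing Implicit Defensive.

Import Order.TTheory GRing.Theory Num.Theory.
Import numFieldNormedType.Exports.

Local Open Scope classical_set_scope.
Local Open Scope ring_scope.

(* The integral converges exactly for 0 < x; [Rintegral] sends a divergent
   integral to 0, so [Gamma x] is meaningful only for 0 < x. *)
Definition Gamma {R : realType} (x : R) : R :=
  Rintegral (@lebesgue_measure R) `]0, +oo[
    (fun t : R => t `^ (x - 1) * expR (- t)).

(* Like [Gamma], meaningful only for 0 < x. *)
Definition digamma {R : realType} (x : R) : R :=
  derive1 (fun y : R => ln (Gamma y)) x.

(* Main.v *)
Require Import Defs.
From HB Require Import structures.
From mathcomp Require Import all_boot all_order all_algebra.
From mathcomp Require Import all_classical all_reals all_analysis.
From mathcomp Require Import measurable_realfun ring lra.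

(** Expanding [1 / (1 - e ^ -t)] as a geometric series and integrating term by
    term turns the integral into the sum over [n] of
    [1 / (p + n) - 1 / (q + n)]; for [p <= q] the terms are nonnegative and
    monotone convergence ([integral_nneseries]) justifies this, and exchanging
    [p] and [q] changes the sign of both sides. It remains to see that this sum
    is [digamma q - digamma p] ([cvg_digamma_diff]), which includes the
    differentiability of [ln Gamma].

    Differentiation under the integral sign is avoided: as in the
    Bohr-Mollerup theorem, everything follows from the functional equation
    [Gamma (x + 1) = x * Gamma x] and from convexity. The functional equation is
    the fundamental theorem of calculus for [t ^ x e ^ -t] on segments
    exhausting the half-line ([eGammaD1]). Convexity is used through Wendel's
    inequality [Gamma (x + h) <= x ^ h * Gamma x] for [0 <= h <= 1]
    ([GammaD_le]), which is Bernoulli's inequality under the integral. The two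
    together pin the slopes of [ln Gamma] at [x] over increments of size at most
    [1] to within [2 / (x - 1)] of [ln x] ([lnGamma_tangent]).

    Applied at [x + n + 1] and brought back to [x] by the functional equation,
    this bound says that the slopes of [ln Gamma] at [x] are, for small
    increments, within [3 / (x + n)] of
    [ln (x + n + 1) - (1 / x + ... + 1 / (x + n))]. As [n] is arbitrary the
    slopes form a Cauchy filter, and their limit, [digamma x], is the limit of
    these expressions ([cvg_digamma_approx]). In the difference between [q] and
    [p] the logarithms cancel in the limit. *)

Set Implicit Arguments.
Unset Strict Implicit.
Unset Printing Implicit Defensive.

Import Order.TTheory GRing.Theory Num.Theory.
Import numFieldNormedType.Exports.

Local Open Scope classical_set_scope.
Local Open Scope ring_scope.

(** * The integrand of the gamma function *)

Definition gamma_fun {R : realType} (x t : R) : R := t `^ (x - 1) * expR (- t).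

Lemma gamma_fun_ge0 (R : realType) (x t : R) : 0 <= gamma_fun x t.
Proof. by rewrite mulr_ge0 ?powR_ge0 ?expR_ge0. Qed.

Lemma measurable_gamma_fun (R : realType) (x : R) (D : set R) :
  measurable_fun D (gamma_fun x).
Proof.
apply: measurable_funTS; apply: measurable_funM => //.
by apply: measurableT_comp => //; exact: measurable_funN.
Qed.

(** The derivative of [t ^ x e ^ -t] is a combination of the integrands of
    [Gamma x] and [Gamma (x + 1)]: this is the integration by parts behind the
    functional equation, written as a single primitive. *)
Lemma is_derive_powR_expRN (R : realType) (x t : R) : 0 < t ->
  is_derive t 1 (fun s => s `^ x * expR (- s))
    (x * gamma_fun x t - gamma_fun (x + 1) t).
Proof.
move=> t0.
have h1 := is_derive1_powR x t0.
have h2 : is_derive t 1 (fun s : R => expR (- s)) (- expR (- t)).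
  have h := is_derive1_comp (is_derive_expR (- t)) (is_deriveNid t 1).
  by apply: (is_derive_eq h); rewrite mulrN1.
apply: (is_derive_eq (is_deriveM h1 h2)).
rewrite /gamma_fun /GRing.scale/= addrK; ring.
Qed.

Lemma continuous_powR_expRN (R : realType) (x t : R) : 0 < t ->
  {for t, continuous (fun s => s `^ x * expR (- s))}.
Proof.
move=> t0; apply/differentiable_continuous/derivable1_diffP.
by have [] := is_derive_powR_expRN x t0.
Qed.

Lemma continuous_gamma_fun (R : realType) (x t : R) : 0 < t ->
  {for t, continuous (gamma_fun x)}.
Proof. exact: continuous_powR_expRN. Qed.

(** Comparison with one term of the exponential series: with [k + 1 >= x + 1],
    [t ^ (x + 1) <= t ^ (k + 1) <= (k + 1)! e ^ t]. *)
Lemma powR_expRN_le (R : realType) (x t : R) (k : nat) :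
  1 <= t -> x + 1 <= k.+1%:R ->
  t `^ x * expR (- t) <= k.+1`!%:R / t.
Proof.
move=> t1 xk; have t0 : 0 < t by exact: lt_le_trans t1.
rewrite ler_pdivlMr// mulrAC.
have /le_trans : t `^ x * t <= t ^+ k.+1.
  rewrite -{2}(powRr1 (ltW t0)) -powRD ?(gt_eqF t0) ?implybT//.
  by rewrite -(powR_mulrn _ (ltW t0)); exact: ler_powR.
rewrite expRN ler_pdivrMr ?expR_gt0//; apply.
have := expR_ge1Dxn k (ltW t0).
rewrite -ler_pdivrMl ?ltr0n ?fact_gt0// mulrC.
by apply: le_trans; rewrite lerDr.
Qed.

Lemma cvg_natSSV0 (R : realType) : ((n.+2%:R : R)^-1) @[n --> \oo] --> (0:R).
Proof.
apply/gtr0_cvgV0; first exact: nearW.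
apply/cvgrnyP; rewrite (_ : (fun n => n.+2) = (fun n => n + 2)%N).
  exact: cvg_addnr.
by apply/funext => n; rewrite addn2.
Qed.

(** The two boundary terms of the integration by parts vanish, here at infinity
    and in [cvg_powR_expRN_natSSV0] at the origin. *)
Lemma cvg_powR_expRN_natSS0 (R : realType) (x : R) :
  ((n.+2%:R : R) `^ x * expR (- n.+2%:R)) @[n --> \oo] --> (0:R).
Proof.
have [k xk] : exists k : nat, x + 1 <= k.+1%:R.
  exists (Num.truncn `|x + 1|).
  by rewrite (le_trans (ler_norm _))// ltW// truncnS_gt.
apply: (@squeeze_cvgr _ _ _ _ (fun=> 0) (fun n => k.+1`!%:R * n.+2%:R^-1)).
- apply: nearW => n; rewrite mulr_ge0 ?powR_ge0 ?expR_ge0//=.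
  by apply: powR_expRN_le => //; rewrite ler1n.
- exact: cvg_cst.
- rewrite -[X in _ --> X](mulr0 (k.+1`!%:R)); apply: cvgMl_tmp.
  exact: cvg_natSSV0.
Qed.

Lemma cvg_powR_expRN_natSSV0 (R : realType) (x : R) : 0 < x ->
  ((n.+2%:R^-1 : R) `^ x * expR (- n.+2%:R^-1)) @[n --> \oo] --> (0:R).
Proof.
move=> x0.
apply: (@squeeze_cvgr _ _ _ _ (fun=> 0) (fun n => (n.+2%:R^-1 : R) `^ x)).
- apply: nearW => n; rewrite mulr_ge0 ?powR_ge0 ?expR_ge0//=.
  by rewrite ler_piMr ?powR_ge0// -expR0 ler_expR oppr_le0 invr_ge0.
- exact: cvg_cst.
- have /cvg_at_rightP := powR_cvg0 x0; apply; split.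
    by move=> n; rewrite invr_gt0.
  exact: cvg_natSSV0.
Qed.

(** * The functional equation *)

Lemma measurable_EFin_gamma_fun (R : realType) (x : R) (D : set R) :
  measurable_fun D (fun t => (gamma_fun x t)%:E).
Proof. by apply/measurable_EFinP; exact: measurable_gamma_fun. Qed.

(** The extended-real integral lets the functional equation be proved before
    finiteness, which is then deduced from it. *)
Definition eGamma {R : realType} (x : R) : \bar R :=
  (\int[@lebesgue_measure R]_(t in `]0%R, +oo[) (gamma_fun x t)%:E)%E.

Lemma eGamma_ge0 (R : realType) (x : R) : (0 <= eGamma x)%E.
Proof. by apply: integral_ge0 => t _; rewrite lee_fin gamma_fun_ge0. Qed.

Lemma within_continuous_gamma_fun (R : realType) (x a b : R) : 0 < a ->
  {within `[a, b], continuous (gamma_fun x)}.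
Proof.
move=> a0; apply: continuous_in_subspaceT => t.
rewrite inE/= in_itv/= => /andP[at_ _].
by apply: continuous_gamma_fun; exact: lt_le_trans at_.
Qed.

Lemma integrable_gamma_fun_segment (R : realType) (x a b : R) : 0 < a ->
  (@lebesgue_measure R).-integrable `[a, b] (fun t => (gamma_fun x t)%:E).
Proof.
move=> a0; apply: (@continuous_compact_integrable R (gamma_fun x)).
  exact: segment_compact.
exact: (@within_continuous_gamma_fun R x a b a0).
Qed.

Lemma integral_gamma_fun_segment (R : realType) (x a b : R) : 0 < a -> a < b ->
  (x%:E * \int[@lebesgue_measure R]_(t in `[a, b]) (gamma_fun x t)%:E =
   \int[@lebesgue_measure R]_(t in `[a, b]) (gamma_fun (x + 1) t)%:E +
   (b `^ x * expR (- b) - a `^ x * expR (- a))%:E)%E.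
Proof.
move=> a0 ab.
have t0 t : t \in `[a, b] -> 0 < t.
  by rewrite in_itv/= => /andP[+ _]; exact: lt_le_trans.
have := @continuous_FTC2 R (fun t => x * gamma_fun x t - gamma_fun (x + 1) t)
  (fun s => s `^ x * expR (- s)) a b ab.
rewrite EFinB => <-; last 3 first.
- apply: continuous_in_subspaceT => t; rewrite inE => /t0 {}t0.
  apply: cvgB; last exact: continuous_gamma_fun.
  by apply: cvgM; [exact: cvg_cst|exact: continuous_gamma_fun].
- split.
  + by move=> t /subset_itv_oo_cc/t0 /(is_derive_powR_expRN x)[].
  + apply: cvg_at_right_filter; exact: continuous_powR_expRN.
  + apply: cvg_at_left_filter; apply: continuous_powR_expRN.
    exact: lt_trans ab.
- move=> t /subset_itv_oo_cc/t0 /(is_derive_powR_expRN x)[_].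
  by rewrite derive1E.
have i0 := @integrable_gamma_fun_segment R x a b a0.
have i1 := @integrable_gamma_fun_segment R (x + 1) a b a0.
under [X in (_ = _ + X)%E]eq_integral do rewrite EFinB EFinM.
rewrite integralB//=; last exact: integrableZl.
rewrite integralZl// addeC subeK// integrable_fin_num//.
Qed.

(** The ends are taken from [n + 2] so that every segment is nondegenerate, as
    the fundamental theorem of calculus requires. *)
Definition exhaust {R : realType} (n : nat) : set R := `[n.+2%:R^-1, n.+2%:R].

Lemma bigcup_exhaust (R : realType) :
  \bigcup_n @exhaust R n = `]0, +oo[%classic.
Proof.
apply/seteqP; split => t.
  move=> [n _]; rewrite /exhaust/= !in_itv/= andbT => /andP[+ _].
  by apply: lt_le_trans; rewrite invr_gt0.
rewrite /= in_itv/= andbT => t0.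
exists (maxn (Num.truncn t) (Num.truncn t^-1)) => //.
rewrite /exhaust/= in_itv/=; apply/andP; split.
  rewrite invf_ple ?posrE// ltW// (lt_le_trans (truncnS_gt _))// ler_nat.
  by rewrite ltnS leqW// leq_maxr.
rewrite ltW// (lt_le_trans (truncnS_gt _))// ler_nat.
by rewrite ltnS leqW// leq_maxl.
Qed.

Lemma cvg_integral_exhaust (R : realType) (x : R) :
  (\int[@lebesgue_measure R]_(t in exhaust n) (gamma_fun x t)%:E)%E @[n --> \oo]
    --> eGamma x.
Proof.
rewrite /eGamma -bigcup_exhaust.
apply: ge0_nondecreasing_set_cvg_integral.
- apply/nondecreasing_seqP => n; rewrite subsetEset => t.
  rewrite /exhaust/= !in_itv/= => /andP[nt tn]; apply/andP; split.
    by apply: le_trans nt; rewrite lef_pV2 ?posrE// ler_nat.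
  by apply: le_trans tn _; rewrite ler_nat.
- by move=> n; exact: measurable_itv.
- by move=> n; exact: measurable_EFin_gamma_fun.
- by move=> n t _; rewrite lee_fin gamma_fun_ge0.
Qed.

(** The identity on the segments [exhaust n] passes to the limit: both
    integrands are nonnegative, so monotone convergence applies without any
    integrability, and the boundary terms tend to [0]. *)
Lemma eGammaD1 (R : realType) (x : R) : 0 < x ->
  eGamma (x + 1) = (x%:E * eGamma x)%E.
Proof.
move=> x0.
have h : (x%:E *
      \int[@lebesgue_measure R]_(t in exhaust n) (gamma_fun x t)%:E)%E
    @[n --> \oo] --> (x%:E * eGamma x)%E.
  by apply: cvgeZl => //; exact: cvg_integral_exhaust.
have := @cvg_integral_exhaust R (x + 1).
pose B (n : nat) : R := (n.+2%:R : R) `^ x * expR (- n.+2%:R) -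
    (n.+2%:R^-1 : R) `^ x * expR (- n.+2%:R^-1).
have cB : (B n)%:E @[n --> \oo] --> 0%E.
  apply: cvg_EFin; first exact: nearW.
  rewrite -[X in _ --> X](subr0 0); apply: cvgB.
    exact: cvg_powR_expRN_natSS0.
  exact: cvg_powR_expRN_natSSV0.
have d0 : (eGamma (x + 1) +? 0)%E by exact: fin_num_adde_defl.
move=> /(cvgeD d0)/(_ cB); rewrite adde0 => h'.
apply: (cvg_unique _ h') => //.
apply: cvg_trans h; apply: near_eq_cvg; apply: nearW => n /=.
apply: integral_gamma_fun_segment; first by rewrite invr_gt0.
by rewrite (@lt_trans _ _ 1) ?invf_lt1 ?ltr1n.
Qed.

Lemma is_derive_expRNM (R : realType) (a t : R) :
  is_derive t 1 (fun s : R => expR (- (a * s))) (- (a * expR (- (a * t)))).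
Proof.
have h : is_derive t 1 (fun s : R => - (a * s)) (- a).
  apply: (is_derive_eq (is_deriveN (is_deriveZ a (is_derive_id t (1 : R))))).
  by rewrite /GRing.scale/= mulr1.
have h' := @is_derive1_comp R expR (fun s : R => - (a * s)) t _ _
  (is_derive_expR _) h.
apply: (is_derive_eq h').
by rewrite mulrN mulrC.
Qed.

Lemma continuous_expRNM (R : realType) (a : R) :
  continuous (fun s : R => expR (- (a * s))).
Proof.
move=> t; apply/differentiable_continuous/derivable1_diffP.
by have [] := is_derive_expRNM a t.
Qed.

Lemma integral_expRNM (R : realType) (a : R) : 0 < a ->
  (\int[@lebesgue_measure R]_(t in `]0%R, +oo[) (expR (- (a * t)))%:E
   = (a^-1)%:E)%E.
Proof.
move=> a0; rewrite integral_itv_obnd_cbnd; last first.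
  apply/measurable_EFinP; apply: measurable_funTS.
  exact: continuous_measurable_fun (@continuous_expRNM R a).
have dF (t : R) : is_derive t 1 (fun s : R => - a^-1 * expR (- (a * s)))
    (expR (- (a * t))).
  apply: (is_derive_eq (is_deriveZ (- a^-1) (is_derive_expRNM a t))).
  rewrite /GRing.scale/= mulrNN mulrA mulVf ?mul1r//.
  by rewrite gt_eqF.
rewrite (@ge0_continuous_FTC2y R _ (fun s => - a^-1 * expR (- (a * s))) 0 0).
- by rewrite mulr0 oppr0 expR0 mulr1 sub0e EFinN oppeK.
- by move=> t _; exact: expR_ge0.
- by apply: continuous_subspaceT; exact: continuous_expRNM.
- rewrite -[X in _ --> X](mulr0 (- a^-1)); apply: cvgMl_tmp.
  apply: (@cvg_comp _ _ _ (fun s => a * s) (fun s => expR (- s))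
    _ (pinfty_nbhs R)); last exact: cvgr_expR.
  exact: gt0_cvgMry.
- by move=> t _; have [] := dF t.
- apply: cvg_at_right_filter.
  by apply: cvgM; [exact: cvg_cst|exact: continuous_expRNM].
- by move=> t _; rewrite derive1E; have [_ ->] := dF t.
Qed.

Lemma eGamma1 (R : realType) : eGamma (1 : R) = 1%E.
Proof.
have := @integral_expRNM R 1 ltr01; rewrite invr1 => <-.
apply: eq_integral => t _; rewrite /gamma_fun subrr powRr0.
by rewrite !mul1r.
Qed.

(** * Finiteness, positivity and log-convexity of the gamma function *)

Lemma eGamma_nat_fin_num (R : realType) (n : nat) :
  eGamma (n.+1%:R : R) \is a fin_num.
Proof.
elim: n => [|n IHn]; first by rewrite eGamma1.
by rewrite -natr1 eGammaD1 ?ltr0n// fin_numM.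
Qed.

Lemma powR_le1D (R : realType) (t x y : R) : 0 < t -> 0 <= x <= y ->
  t `^ x <= 1 + t `^ y.
Proof.
move=> t0 /andP[x0 xy]; have [t1|/ltW t1] := leP t 1.
  rewrite (@le_trans _ _ 1) ?lerDl ?powR_ge0// -(powRr0 t).
  by apply: ger_powR => //; rewrite t0.
rewrite (@le_trans _ _ (t `^ y)) ?lerDr//.
exact: ler_powR.
Qed.

(** At positive integers the value is finite by the functional equation and
    [eGamma 1 = 1]; for [1 <= z] the integrand lies below the sum of the
    integrands at [1] and at an integer above [z]; the remaining [x < 1] are
    reached by one more use of the functional equation. *)
Lemma eGamma_fin_num (R : realType) (x : R) : 0 < x -> eGamma x \is a fin_num.
Proof.
have main (z : R) : 1 <= z -> eGamma z \is a fin_num.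
  move=> z1; rewrite ge0_fin_numE ?eGamma_ge0//.
  have zn : z <= (Num.truncn z).+1%:R by rewrite ltW// truncnS_gt.
  set n := Num.truncn z in zn.
  apply: (@le_lt_trans _ _ (eGamma (1 : R) + eGamma (n.+1%:R : R))%E).
    rewrite /eGamma -ge0_integralD//=; last 4 first.
    - by move=> t _; rewrite lee_fin gamma_fun_ge0.
    - exact: measurable_EFin_gamma_fun.
    - by move=> t _; rewrite lee_fin gamma_fun_ge0.
    - exact: measurable_EFin_gamma_fun.
    apply: ge0_le_integral => //=.
    - by move=> t _; rewrite lee_fin gamma_fun_ge0.
    - exact: measurable_EFin_gamma_fun.
    - apply: emeasurable_funD; exact: measurable_EFin_gamma_fun.
    - move=> t; rewrite in_itv/= andbT => t0.
      rewrite -EFinD lee_fin /gamma_fun -mulrDl ler_wpM2r ?expR_ge0//.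
      by rewrite subrr powRr0 powR_le1D// subr_ge0 z1 lerD2r.
  by rewrite lte_add_pinfty// ltey_eq ?eGamma1// eGamma_nat_fin_num.
move=> x0; have := main (x + 1); rewrite lerDr ltW// => /(_ isT).
rewrite eGammaD1// => fx.
rewrite ge0_fin_numE ?eGamma_ge0// ltey; apply/eqP => gy.
by move: fx; rewrite gy gt0_muley// lte_fin.
Qed.

Lemma GammaE (R : realType) (x : R) : 0 < x -> eGamma x = (Gamma x)%:E.
Proof. by move=> x0; rewrite /Gamma /Rintegral fineK ?eGamma_fin_num. Qed.

Lemma GammaD1 (R : realType) (x : R) : 0 < x -> Gamma (x + 1) = x * Gamma x.
Proof.
move=> x0; apply: EFin_inj.
by rewrite EFinM -!GammaE ?addr_gt0// eGammaD1.
Qed.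

Lemma Gamma1 (R : realType) : Gamma 1 = 1 :> R.
Proof. by apply: EFin_inj; rewrite -GammaE// eGamma1. Qed.

(** Convexity of the exponential between [0] and [ln s]. *)
Lemma powR_bernoulli (R : realType) (h s : R) : 0 <= h <= 1 -> 0 < s ->
  s `^ h <= 1 - h + h * s.
Proof.
move=> /andP[h0 h1] s0.
have := convex_expR (Itv01 h0 h1) (ln s) 0.
rewrite !convRE/= mulr0 addr0 expR0 mulr1 lnK ?posrE// /powR gt_eqF//.
by rewrite addrC.
Qed.

(** Bernoulli's inequality for [s = t / x]. The base point [x], which is about
    where the mass of the integrand sits, is the choice that makes the
    integrated bound collapse to [x ^ h * Gamma x]. *)
Lemma gamma_funD_le (R : realType) (x h t : R) :
  0 < x -> 0 <= h <= 1 -> 0 < t ->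
  gamma_fun (x + h) t <=
  x `^ h * (1 - h) * gamma_fun x t + x `^ h * (h / x) * gamma_fun (x + 1) t.
Proof.
move=> x0 h01 t0; rewrite /gamma_fun !mulrA -mulrDl ler_wpM2r ?expR_ge0//.
have tx0 : 0 < t / x by rewrite divr_gt0.
have tD y : t `^ (x + y - 1) = t `^ (x - 1) * t `^ y.
  by rewrite addrAC [LHS]powRD// (gt_eqF t0) implybT.
rewrite !tD (powRr1 (ltW t0)).
have -> : t `^ h = (t / x) `^ h * x `^ h.
  by rewrite -powRM ?ltW// divfK ?gt_eqF.
have := powR_bernoulli h01 tx0.
move: (powR_gt0 (x - 1) t0) (powR_gt0 h x0) (@powR_ge0 R (t / x) h).
set A := t `^ (x - 1); set B := x `^ h; set C := (t / x) `^ h.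
move=> A0 B0 C0 /(ler_wpM2l (ltW (mulr_gt0 A0 B0))).
rewrite (_ : A * (C * B) = A * B * C); last by ring.
move/le_trans; apply; rewrite le_eqVlt; apply/orP; left; apply/eqP; field.
exact: lt0r_neq0.
Qed.

(** Wendel's inequality, the form in which the log-convexity of [Gamma] is used:
    the pointwise bound [gamma_funD_le] integrates to
    [x ^ h * ((1 - h) * Gamma x + (h / x) * Gamma (x + 1))], and
    [Gamma (x + 1) = x * Gamma x]. *)
Lemma GammaD_le (R : realType) (x h : R) : 0 < x -> 0 <= h <= 1 ->
  Gamma (x + h) <= x `^ h * Gamma x.
Proof.
move=> x0 h01; have /andP[h0 h1] := h01.
have c1 : 0 <= x `^ h * (1 - h) by rewrite mulr_ge0 ?powR_ge0 ?subr_ge0.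
have c2 : 0 <= x `^ h * (h / x) by rewrite mulr_ge0 ?powR_ge0// divr_ge0// ltW.
rewrite (_ : x `^ h * Gamma x =
  x `^ h * (1 - h) * Gamma x + x `^ h * (h / x) * Gamma (x + 1)); last first.
  by rewrite GammaD1//; field; exact: lt0r_neq0.
rewrite -lee_fin EFinD !EFinM -!GammaE ?ltr_wpDr//.
rewrite -!EFinM /eGamma -!ge0_integralZl_EFin//; last 4 first.
- by move=> t _; rewrite lee_fin gamma_fun_ge0.
- exact: measurable_EFin_gamma_fun.
- by move=> t _; rewrite lee_fin gamma_fun_ge0.
- exact: measurable_EFin_gamma_fun.
rewrite -ge0_integralD//=; last 4 first.
- by move=> t _; rewrite lee_fin mulr_ge0// gamma_fun_ge0.
- apply/measurable_EFinP; apply: measurable_funM => //.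
  exact: measurable_gamma_fun.
- by move=> t _; rewrite lee_fin mulr_ge0// gamma_fun_ge0.
- apply/measurable_EFinP; apply: measurable_funM => //.
  exact: measurable_gamma_fun.
apply: ge0_le_integral => //=.
- by move=> t _; rewrite lee_fin gamma_fun_ge0.
- exact: measurable_EFin_gamma_fun.
- by apply/measurable_EFinP; apply: measurable_funD;
    apply: measurable_funM => //;
    exact: measurable_gamma_fun.
- move=> t; rewrite in_itv/= andbT => t0; rewrite lee_fin.
  exact: gamma_funD_le.
Qed.

(** For [z <= 1], Wendel's inequality with [h = 1 - z] bounds
    [Gamma 1 = 1] by [z ^ h * Gamma z]; larger arguments follow from the
    functional equation. *)
Lemma Gamma_gt0 (R : realType) (x : R) : 0 < x -> 0 < Gamma x.
Proof.
have main (n : nat) : forall z : R, 0 < z -> z <= n%:R -> 0 < Gamma z.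
  elim: n => [z z0 /(lt_le_trans z0)|n IHn z z0 zn]; first by rewrite ltxx.
  have [z1|z1] := leP z 1.
    have := @GammaD_le R z (1 - z) z0.
    rewrite subr_ge0 z1 gerBl ltW// addrC subrK Gamma1 => /(_ isT).
    by move=> /(lt_le_trans ltr01); rewrite pmulr_rgt0 ?powR_gt0.
  rewrite -(subrK 1 z) GammaD1 ?subr_gt0// mulr_gt0 ?subr_gt0//.
  by apply: IHn; rewrite ?subr_gt0// lerBlDr natr1.
move=> x0; apply: (main (Num.truncn x).+1) => //.
by rewrite ltW// truncnS_gt.
Qed.

(** * Differentiability of the logarithm of the gamma function *)

Definition lnGamma {R : realType} (x : R) : R := ln (Gamma x).

Lemma lnGammaD1 (R : realType) (x : R) : 0 < x ->
  lnGamma (x + 1) = ln x + lnGamma x.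
Proof.
by move=> x0; rewrite /lnGamma GammaD1// lnM ?posrE// Gamma_gt0.
Qed.

Lemma lnGammaDn (R : realType) (x : R) (n : nat) : 0 < x ->
  lnGamma (x + n%:R) = lnGamma x + \sum_(j < n) ln (x + j%:R).
Proof.
move=> x0; elim: n => [|n IHn]; first by rewrite addr0 big_ord0 addr0.
rewrite -natr1 addrA lnGammaD1 ?ltr_wpDr// IHn big_ord_recr/=.
ring.
Qed.

Lemma lnD_le (R : realType) (x h : R) : 0 < x -> 0 <= h ->
  ln (x + h) <= ln x + h / x.
Proof.
move=> x0 h0.
have -> : x + h = x * (1 + h / x) by field; exact: lt0r_neq0.
have h1 : 0 <= h / x by rewrite divr_ge0// ltW.
rewrite lnM ?posrE ?ltr_wpDr// lerD2l le_ln1Dx//.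
by rewrite (lt_le_trans _ h1)// ltrN10.
Qed.

Lemma lnGammaD_le (R : realType) (x h : R) : 0 < x -> 0 <= h <= 1 ->
  lnGamma (x + h) - lnGamma x <= h * ln x.
Proof.
move=> x0 /[dup] h01 /andP[h0 h1].
rewrite lerBlDr -[h * _]expRK.
have -> : expR (h * ln x) = x `^ h by rewrite /powR gt_eqF.
rewrite -lnM ?posrE ?powR_gt0 ?Gamma_gt0// ler_ln ?posrE; last 2 first.
- by rewrite Gamma_gt0// ltr_wpDr.
- by rewrite mulr_gt0 ?powR_gt0 ?Gamma_gt0.
exact: GammaD_le.
Qed.

(** Wendel's upper bound at [x + h] with increment [1 - h] lands on [x + 1],
    where the functional equation brings back [x]. *)
Lemma lnGammaD_ge (R : realType) (x h : R) : 0 < x -> 0 <= h <= 1 ->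
  h * ln x - h / x <= lnGamma (x + h) - lnGamma x.
Proof.
move=> x0 /[dup] h01 /andP[h0 h1].
have xh0 : 0 < x + h by rewrite ltr_wpDr.
have k01 : 0 <= 1 - h <= 1 by rewrite subr_ge0 h1 gerBl h0.
have := lnGammaD_le xh0 k01.
rewrite (_ : x + h + (1 - h) = x + 1); last by ring.
rewrite lnGammaD1//.
have /(ler_wpM2l (_ : 0 <= 1 - h)) := lnD_le x0 h0.
rewrite subr_ge0 => /(_ h1).
have hx0 : 0 <= h / x by rewrite divr_ge0// ltW.
have : 0 <= h * (h / x) by rewrite mulr_ge0.
rewrite !mulrBl !mul1r mulrDr.
move: (h / x) (ln x) (ln (x + h)) (lnGamma x) (lnGamma (x + h)) hx0.
move=> a b c u v; move: (h * a) (h * b) (h * c) => ha hb hc.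
clear; lra.
Qed.

(** At a large [x], [lnGamma] is almost linear of slope [ln x] on the whole
    unit ball around [x]. A negative increment is an increment [- h] from the
    base point [x + h], which explains the denominator [x - 1]. *)
Lemma lnGamma_tangent (R : realType) (x h : R) : 1 < x -> `|h| <= 1 ->
  `|lnGamma (x + h) - lnGamma x - h * ln x| <= `|h| * (2 / (x - 1)).
Proof.
move=> x1 h1; have x0 : 0 < x by exact: lt_trans x1.
have x10 : 0 < x - 1 by rewrite subr_gt0.
have [h0|h0] := leP 0 h.
  have h01 : 0 <= h <= 1 by rewrite h0 (le_trans (ler_norm _)).
  have := lnGammaD_le x0 h01; have := lnGammaD_ge x0 h01.
  have : h / x <= h * (2 / (x - 1)).
    apply: ler_wpM2l => //; rewrite (@le_trans _ _ (x - 1)^-1)//.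
      by rewrite lef_pV2 ?posrE// gerBl.
    by rewrite ler_peMl ?invr_ge0 ?ltW// ltr1n.
  have : 0 <= h * (2 / (x - 1)).
    by rewrite mulr_ge0// divr_ge0// ltW.
  rewrite (ger0_norm h0) ler_norml.
  move: (lnGamma (x + h)) (lnGamma x) (h / x) (h * ln x) (h * (2 / (x - 1))).
  by move=> a b u v w ? ? ? ?; apply/andP; split; lra.
have k01 : 0 <= - h <= 1.
  by rewrite oppr_ge0 ltW//= (le_trans (ler_norm _))// normrN.
have /andP[k0 k1] := k01.
have y0 : 0 < x + h by lra.
have := lnGammaD_le y0 k01; have := lnGammaD_ge y0 k01.
rewrite addrK.
have := lnD_le y0 k0; rewrite addrK => /(ler_wpM2l k0).
have : ln (x + h) <= ln x by rewrite ler_ln ?posrE// gerDl ltW.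
move=> /(ler_wpM2l k0).
have : - h / (x + h) <= - h * (1 / (x - 1)).
  by rewrite ler_wpM2l// div1r lef_pV2 ?posrE// lerD2l; lra.
have : - h * (- h / (x + h)) <= - h / (x + h).
  by rewrite ler_piMl// divr_ge0// ltW.
rewrite (ltr0_norm h0) ler_norml.
move: (- h / (x + h)) (lnGamma (x + h)) (lnGamma x) (ln (x + h)) => d a b l.
rewrite -[2 / _]/(2 * (x - 1)^-1) div1r.
move: (x - 1)^-1 (ln x) => m n.
rewrite !mulrDr.
move: (- h * d) => kd.
move: (- h * l) => kl.
have -> : h * n = - (- h * n) by rewrite mulNr opprK.
move: (- h * n) => kn.
have -> : - h * (2 * m) = 2 * (- h * m) by ring.
move: (- h * m) => km ? ? ? ? ? ?; apply/andP; split; lra.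
Qed.

(** If [f] is eventually within [e n] of [d n] for every [n], with [e n]
    vanishing, then [f] is Cauchy along the filter, and its limit is also the
    limit of [d]. One argument thus gives both the existence of a derivative and
    a formula for it. *)
Lemma cvg_approx (R : realType) (T : Type) (F : set_system T)
    (FF : ProperFilter F) (f : T -> R) (d e : R^nat) :
  e @ \oo --> (0 : R) -> (forall n, \forall h \near F, `|f h - d n| <= e n) ->
  exists l : R, f @ F --> l /\ d @ \oo --> l.
Proof.
move=> e0 fd.
have cf : cvg (f @ F).
  apply/cauchy_cvgP; apply: cauchy_exP => eps eps0.
  have [n _ /(_ n (leqnn n)) en] := cvgr_lt 0 e0 _ eps0.
  exists (d n); apply: filterS (fd n) => h /= fh.
  by rewrite /ball/= distrC (le_lt_trans fh).
exists (lim (f @ F)); split=> //.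
have ld n : `|lim (f @ F) - d n| <= e n.
  have c : `|f h - d n| @[h --> F] --> `|lim (f @ F) - d n|.
    by apply: cvg_norm; apply: cvgB => //; exact: cvg_cst.
  by rewrite -(cvg_lim _ c)//; apply: limr_le => //; exact: cvgP c.
apply/cvgrPdist_le => eps eps0.
apply: filterS (cvgr_le 0 e0 _ eps0) => n en.
exact: le_trans (ld n) en.
Qed.

Lemma cvg_divDn0 (R : realType) (c x : R) : 0 < x ->
  c / (x + n%:R) @[n --> \oo] --> (0 : R).
Proof.
move=> x0; rewrite -[X in _ --> X](mulr0 c); apply: cvgMl_tmp.
apply/gtr0_cvgV0; first by apply: nearW => n; rewrite ltr_wpDr.
apply/cvgryPge => A; near=> n.
rewrite (@le_trans _ _ n%:R)//; last by rewrite lerDr ltW.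
by near: n; exact: nbhs_infty_ger.
Unshelve. all: by end_near. Qed.

Definition digamma_approx {R : realType} (x : R) (n : nat) : R :=
  ln (x + n.+1%:R) - \sum_(j < n.+1) (x + j%:R)^-1.

Lemma cvg_ln_slope (R : realType) (x : R) : 0 < x ->
  h^-1 * (ln (h + x) - ln x) @[h --> 0^'] --> x^-1.
Proof.
move=> x0; have [dln] := is_derive1_ln x0.
rewrite -derive1E /derive1 => <-.
move: dln; rewrite /derivable; under eq_fun do rewrite /= scaler1.
by [].
Qed.

(** The functional equation moves the slope of [lnGamma] at [x] to
    [x + n + 1], where [lnGamma_tangent] bounds its distance to
    [ln (x + n + 1)] by [2 / (x + n)]; the slopes of the logarithms so
    introduced tend to [1 / (x + j)], which costs one more [1 / (x + n)]. *)
Lemma lnGamma_slope_near (R : realType) (x : R) (n : nat) : 0 < x ->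
  \forall h \near 0^',
    `|h^-1 * (lnGamma (h + x) - lnGamma x) - digamma_approx x n|
      <= 3 / (x + n%:R).
Proof.
move=> x0; have xn0 : 0 < x + n%:R by rewrite ltr_wpDr.
pose S h : R := \sum_(j < n.+1) h^-1 * (ln (h + (x + j%:R)) - ln (x + j%:R)).
have cS : S h @[h --> 0^'] --> \sum_(j < n.+1) (x + j%:R)^-1.
  apply: cvg_big => [|j _]; first exact: add_continuous.
  by apply: cvg_ln_slope; rewrite ltr_wpDr.
have ei : 0 < (x + n%:R)^-1 by rewrite invr_gt0.
have nS := cvgr_dist_le _ _ cS _ ei.
near=> h.
have h0 : h != 0 by near: h; exact: nbhs_dnbhs_neq.
have h1 : `|h| <= 1.
  near: h; apply: dnbhs0_le; exact: ltr01.
have hx : 0 < h + x.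
  have : `|h| < x by near: h; exact: dnbhs0_lt.
  by rewrite ltr_norml => /andP[]; lra.
have Sh : `|\sum_(j < n.+1) (x + j%:R)^-1 - S h| <= (x + n%:R)^-1.
  by near: h; exact: nS.
have x1 : 1 < x + n.+1%:R by rewrite -natr1 addrA ltrDr.
have := lnGamma_tangent x1 h1.
rewrite (_ : x + n.+1%:R + h = h + x + n.+1%:R); last by ring.
rewrite !lnGammaDn//.
have -> : x + n.+1%:R - 1 = x + n%:R by rewrite -natr1; ring.
(* [S h] collects the slopes of the logarithms that the shift by [n + 1]
   introduces. *)
have -> : lnGamma (h + x) + \sum_(j < n.+1) ln (h + x + j%:R) -
   (lnGamma x + \sum_(j < n.+1) ln (x + j%:R)) - h * ln (x + n.+1%:R) =
   h * (h^-1 * (lnGamma (h + x) - lnGamma x) - (ln (x + n.+1%:R) - S h)).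
  have -> : \sum_(j < n.+1) ln (h + x + j%:R) =
      \sum_(j < n.+1) ln (x + j%:R) + h * S h.
    rewrite mulr_sumr -big_split/=; apply: eq_bigr => j _.
    by rewrite mulrA divff// mul1r addrCA subrr addr0 addrA.
  move: (lnGamma _) (lnGamma _) (\sum_(_ < _) _) (S h) (ln _) => a b c d l.
  rewrite mulrBr mulVKf//; ring.
rewrite normrM ler_pM2l ?normr_gt0// => tan.
rewrite /digamma_approx.
move: tan Sh; set A := h^-1 * _; set L := ln _; set B := \sum_(_ < _) _.
move=> tan Sh.
have -> : A - (L - B) = (A - (L - S h)) + (B - S h) by ring.
rewrite (le_trans (ler_normD _ _))// (le_trans (lerD tan Sh))//.
rewrite le_eqVlt; apply/orP; left; apply/eqP; field.
exact: lt0r_neq0.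
Unshelve. all: by end_near. Qed.

Lemma cvg_digamma_approx (R : realType) (x : R) : 0 < x ->
  digamma_approx x n @[n --> \oo] --> digamma x.
Proof.
move=> x0.
have [l [fl dl]] := cvg_approx _ (cvg_divDn0 3 x0)
   (fun n => lnGamma_slope_near n x0).
by rewrite /digamma /derive1 (cvg_lim _ fl).
Qed.

Lemma cvg_ln_shift_diff0 (R : realType) (p q : R) : 0 < p -> 0 < q ->
  ln (q + n%:R) - ln (p + n%:R) @[n --> \oo] --> (0 : R).
Proof.
have main (a b : R) n : 0 < a -> 0 < b ->
    ln (b + n%:R) - ln (a + n%:R) <= `|b - a| / (a + n%:R).
  move=> a0 b0.
  have an : 0 < a + n%:R by rewrite ltr_wpDr.
  have bn : 0 < b + n%:R by rewrite ltr_wpDr.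
  rewrite lerBlDl; apply: (le_trans _ (lnD_le an (normr_ge0 (b - a)))).
  rewrite ler_ln ?posrE//; last by rewrite ltr_wpDr.
  rewrite addrAC lerD2r -lerBlDl; exact: ler_norm.
move=> p0 q0.
apply: (@squeeze_cvgr _ _ _ _ (fun n => - (`|p - q| / (q + n%:R)))
   (fun n => `|q - p| / (p + n%:R))).
- by apply: nearW => n; rewrite main// andbT lerNl opprB main.
- rewrite -oppr0; apply: cvgN; exact: cvg_divDn0.
- exact: cvg_divDn0.
Qed.

(** The logarithms in [digamma_approx q n - digamma_approx p n] cancel in the
    limit. *)
Lemma cvg_digamma_diff (R : realType) (p q : R) : 0 < p -> 0 < q ->
  \sum_(0 <= j < n) ((p + j%:R)^-1 - (q + j%:R)^-1) @[n --> \oo]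
    --> digamma q - digamma p.
Proof.
move=> p0 q0; rewrite -cvg_shiftS.
have c : digamma_approx q n - digamma_approx p n @[n --> \oo] -->
    digamma q - digamma p by apply: cvgB; exact: cvg_digamma_approx.
have l : ln (q + n.+1%:R) - ln (p + n.+1%:R) @[n --> \oo] --> (0 : R).
  rewrite (cvg_shiftS (fun n => ln (q + n%:R) - ln (p + n%:R))).
  exact: cvg_ln_shift_diff0.
rewrite -(subr0 (digamma q - digamma p)); apply: cvg_trans (cvgB c l).
apply: near_eq_cvg; apply: nearW => n /=.
rewrite big_mkord sumrB/= /digamma_approx !fctE; ring.
Qed.

(** * Integration of the geometric expansion *)

Lemma integrable_expRNM (R : realType) (a : R) : 0 < a ->
  (@lebesgue_measure R).-integrable `]0%R, +oo[
    (fun t => (expR (- (a * t)))%:E).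
Proof.
move=> a0; apply/integrableP; split.
  apply/measurable_EFinP; apply: measurable_funTS.
  exact: continuous_measurable_fun (@continuous_expRNM R a).
under eq_integral do rewrite /= ger0_norm ?expR_ge0//.
by rewrite integral_expRNM// ltry.
Qed.

Lemma integral_expRNMB (R : realType) (a b : R) : 0 < a -> 0 < b ->
  (\int[@lebesgue_measure R]_(t in `]0%R, +oo[)
     (expR (- (a * t)) - expR (- (b * t)))%:E = (a^-1 - b^-1)%:E)%E.
Proof.
move=> a0 b0; under eq_integral do rewrite EFinB.
rewrite integralB//=; [|exact: integrable_expRNM|exact: integrable_expRNM].
by rewrite !integral_expRNM.
Qed.

Lemma eseries_EFin (R : realType) (u : R^nat) (l : R) :
  (\sum_(0 <= j < n) u j) @[n --> \oo] --> l ->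
  (\sum_(n <oo) (u n)%:E = l%:E)%E.
Proof.
move=> ul; apply/cvg_lim => //.
under eq_fun do rewrite sumEFin.
by apply: cvg_EFin => //; exact: nearW.
Qed.

Lemma expRNM_geometric_series (R : realType) (p q t : R) : 0 < t ->
  (\sum_(n <oo) (expR (- ((p + n%:R) * t)) - expR (- ((q + n%:R) * t)))%:E =
   ((expR (- (p * t)) - expR (- (q * t))) / (1 - expR (- t)))%:E)%E.
Proof.
move=> t0; apply: eseries_EFin.
have et : `|expR (- t)| < 1.
  by rewrite ger0_norm ?expR_ge0// -expR0 ltr_expR oppr_lt0.
have := @cvg_geometric_series R (expR (- (p * t)) - expR (- (q * t))) _ et.
apply: cvg_trans; apply: near_eq_cvg; apply: nearW => n.
rewrite /series/=; apply: eq_bigr => j _.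
have e (a : R) : expR (- ((a + j%:R) * t)) = expR (- (a * t)) * expR (- t) ^+ j.
  by rewrite -expRM_natl -expRD; congr expR; rewrite -mulr_natr; ring.
by rewrite !e -mulrBl.
Qed.

(** For [p <= q] all the terms of the geometric expansion are nonnegative, so
    that it can be integrated term by term. *)
Lemma integral_digamma_le (R : realType) (p q : R) : 0 < p -> p <= q ->
  (\int[@lebesgue_measure R]_(t in `]0%R, +oo[)
     ((expR (- (p * t)) - expR (- (q * t))) / (1 - expR (- t)))%:E
   = (digamma q - digamma p)%:E)%E.
Proof.
move=> p0 pq; have q0 : 0 < q by exact: lt_le_trans pq.
under eq_integral => t.
  rewrite inE/= in_itv/= andbT => t0.
  rewrite -expRNM_geometric_series//; over.
rewrite integral_nneseries//=; last 2 first.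
- move=> n; apply/measurable_EFinP; apply: measurable_funTS.
  by apply: measurable_funB; apply: continuous_measurable_fun;
    exact: continuous_expRNM.
- move=> n t; rewrite in_itv/= andbT => t0.
  by rewrite lee_fin subr_ge0 ler_expR lerN2 ler_wpM2r ?lerD2r// ltW.
under eq_eseriesr => n _ do rewrite integral_expRNMB ?ltr_wpDr//.
by apply: eseries_EFin; exact: cvg_digamma_diff.
Qed.

(* The integral is extended-real valued, so an equality with a real number also
   asserts convergence. *)
Theorem proposition5p4 (R : realType) (p q : R) (hp : 0 < p) (hq : 0 < q) :
  (\int[@lebesgue_measure R]_(t in `]0%R, +oo[)
     ((expR (- (p * t)) - expR (- (q * t))) / (1 - expR (- t)))%:E
   = (digamma q - digamma p)%:E)%E.
Proof.
have [pq|/ltW qp] := leP p q; first exact: integral_digamma_le.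
rewrite -(opprB (digamma p)) EFinN -(integral_digamma_le hq qp).
rewrite -integral_ge0N/=; last first.
  move=> t; rewrite in_itv/= andbT => t0.
  rewrite lee_fin divr_ge0// subr_ge0; last first.
    by rewrite -expR0 ler_expR oppr_le0 ltW.
  by rewrite ler_expR lerN2 ler_wpM2r// ltW.
by apply: eq_integral => t _; congr EFin; rewrite -[RHS]mulNr opprB.
Qed.
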